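(* Let $G=(V,E)$ be a connected graph. The following statements are equivalent: (i) $G$ is a partial cube. (ii) $G$ is bipartite and all semicubes of $G$ are convex. (iii) $G$ is bipartite and $\theta$ is an equivalence relation on $E$. (iv) $G$ is bipartite and, for all $xy,uv\in E$, $xy\,\theta\,uv$ implies $\{W_{xy},W_{yx}\}=\{W_{uv},W_{vu}\}$. (v) $G$ is bipartite and, for any pair of adjacent vertices of $G$, there is a unique pair of opposite semicubes separating these two vertices.
   Context: Graphs are simple, undirected, nonempty, and not necessarily finite; $d$ denotes the shortest-path distance in $G$. For a set $X$, the hypercube $\mathcal H(X)$ is the graph whose vertices are the finite subsets of $X$, with $P,Q$ adjacent iff $|P\Delta Q|=1$. A graph is a partial cube if it can be isometrically embedded (i.e. by a map preserving shortest-path distances) into $\mathcal H(X)$ for some set $X$. For adjacent $a,b\in V$ the semicube $W_{ab}$ is $W_{ab}=\{w\in V: d(w,a)<d(w,b)\}$; $W_{ab}$ and $W_{ba}$ are opposite semicubes, and a pair of opposite semicubes is the unordered pair of sets $\{W_{ab},W_{ba}\}$. Such a pair separates two vertices if one of the vertices lies in $W_{ab}$ and the other in $W_{ba}$. A set of vertices $W$ is convex if every shortest path in $G$ between two vertices of $W$ lies in $W$. Djokovi\'c's relation $\theta$ on $E$: $xy\,\theta\, f$ iff the edge $f$ joins a vertex in $W_{xy}$ with a vertex in $W_{yx}$. *)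

(* Defs.v *)
From mathcomp Require Import all_boot finmap.
From mathcomp Require Import boolp classical_sets.
From Stdlib Require RelationClasses.

Set Implicit Arguments.
Unset Strict Implicit.
Unset Printing Implicit Defensive.

Local Open Scope classical_set_scope.

(* Possibly infinite: [vertex] is any choiceType, which under the axioms of
   [boolp] is no restriction on the set of vertices. *)
Record sgraph := SGraph {
  vertex :> choiceType;
  adj : rel vertex;
  adj_sym : symmetric adj;
  adj_irrefl : irreflexive adj;
  vertex_inhabited : inhabited vertex }.

Section Graph.
Variable G : sgraph.
Implicit Types (x y a b u v w : G) (p : seq G) (e f : set G).

(* [x :: p] is the list of vertices of the path, so its length is [size p]. *)
Definition is_path x y p : bool :=
  [&& path (@adj G) x p, uniq (x :: p) & last x p == y].

Definition connected_graph : Prop := forall x y, exists p, is_path x y p.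

Definition path_of_length x y (n : nat) : bool :=
  `[< exists2 p, is_path x y p & size p = n >].

(* 0 if no path joins [x] to [y]: meaningful in connected graphs only, and
   hypercubes are connected ([hypercube_connected] below). *)
Definition dist x y : nat :=
  if pselect (exists n, path_of_length x y n) is left ex_n then ex_minn ex_n
  else 0.

Definition bipartite : Prop :=
  exists c : G -> bool, forall x y, adj x y -> c x != c y.

Definition semicube a b : set G := [set w | dist w a < dist w b].

Definition convex (W : set G) : Prop :=
  forall x y p, W x -> W y -> is_path x y p -> size p = dist x y ->
  forall z, z \in x :: p -> W z.

Definition edges : set (set G) :=
  [set e | exists x y, adj x y /\ e = [set x; y]].

Definition theta e f : Prop :=
  exists x y u v,
    [/\ adj x y /\ e = [set x; y], adj u v /\ f = [set u; v],
        semicube x y u & semicube y x v].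

Definition theta_equivalence : Prop :=
  RelationClasses.Equivalence
    (fun e f : set_type edges => theta (val e) (val f)).

Definition opposite_semicubes a b : set (set G) :=
  [set semicube a b; semicube b a].

Definition opposite_pair (S : set (set G)) : Prop :=
  exists a b, adj a b /\ S = opposite_semicubes a b.

Definition separates (S : set (set G)) x y : Prop :=
  exists A B : set G, [/\ S = [set A; B], A x & B y].

End Graph.

Definition isometric (G H : sgraph) (f : G -> H) : Prop :=
  forall x y, dist (f x) (f y) = dist x y.

Section Hypercube.
Variable X : choiceType.
Implicit Types P Q : {fset X}.

Definition hypercube_adj P Q : bool :=
  #|` ((P `\` Q) `|` (Q `\` P))%fset | == 1.

Lemma hypercube_adj_sym : symmetric hypercube_adj.
Proof. by move=> P Q; rewrite /hypercube_adj fsetUC. Qed.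

Lemma hypercube_adj_irrefl : irreflexive hypercube_adj.
Proof. by move=> P; rewrite /hypercube_adj fsetDv fsetUid cardfs0. Qed.

Definition hypercube : sgraph :=
  SGraph hypercube_adj_sym hypercube_adj_irrefl (inhabits fset0).

Lemma hypercube_connected : connected_graph hypercube.
Proof.
have from0 (Q : {fset X}) :
    exists2 p, path hypercube_adj fset0 p & last fset0 p = Q.
  elim/finSet_rect: Q => Q IH.
  have [->|[x xQ]] := fset_0Vmem Q; first by exists [::].
  have [|p pP pl] := IH (Q `\ x)%fset; first by rewrite fproperD1.
  exists (rcons p Q); last by rewrite last_rcons.
  rewrite rcons_path pP pl /= /hypercube_adj.
  suff -> : ((Q `\ x `\` Q) `|` (Q `\` (Q `\ x)) = [fset x])%fset.
    by rewrite cardfs1.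
  apply/fsetP => z; rewrite !inE.
  by case: (eqVneq z x) => [->|_]; rewrite ?xQ //=; case: (z \in Q).
move=> /= P Q.
have [p pP pl] := from0 P; have [q qP ql] := from0 Q.
pose r := rev (belast fset0 p) ++ q.
have rP : path hypercube_adj P r.
  rewrite cat_path -{1}pl rev_path.
  rewrite (eq_path (e' := hypercube_adj)); last first.
    by move=> A B; rewrite hypercube_adj_sym.
  rewrite pP /=; suff -> : last P (rev (belast fset0 p)) = fset0 by [].
  by rewrite -pl; case: (p) => [|A s] //=; rewrite rev_cons last_rcons.
have rl : last P r = Q.
  rewrite last_cat; suff -> : last P (rev (belast fset0 p)) = fset0 by [].
  by rewrite -pl; case: (p) => [|A s] //=; rewrite rev_cons last_rcons.
case: (shortenP rP) rl => s sP su _ sl.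
by exists s; rewrite /is_path sP su sl eqxx.
Qed.

End Hypercube.

Definition partial_cube (G : sgraph) : Prop :=
  exists (X : choiceType) (f : G -> hypercube X), isometric f.

(* Main.v *)
Require Import Defs.
From mathcomp Require Import all_boot finmap.
From mathcomp Require Import boolp classical_sets.
From mathcomp Require Import cardinality zify.

(* In a bipartite graph opposite semicubes are complementary, so (ii)-(v) are
   each equivalent to: if an edge uv joins W_xy to W_yx, with u in W_xy, then
   W_uv = W_xy.  Semicubes of a hypercube consist of the sets with a prescribed
   membership of one element t, and they are convex because flipping t in a
   vertex of the wrong side brings it closer to all vertices of the right side;
   convexity is inherited by isometric subgraphs.
   Conversely, fix a vertex r and map z to the finite set of semicubes
   containing z but not r.  The ends of an edge yz are separated only by the
   pair W_yz, W_zy, so the image changes by exactly one element along yz.  If y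
   precedes z on a geodesic from w, then w and y lie on the same side of that
   pair, so the image of z is one step further from that of w than the image
   of y is. *)

Local Open Scope classical_set_scope.

Lemma set2_eq {T : Type} {x y u v : T} :
  [set x; y] = [set u; v] -> x = u /\ y = v \/ x = v /\ y = u.
Proof.
move=> E.
have xE : x = u \/ x = v by change ([set u; v] x); rewrite -E; left.
have yE : y = u \/ y = v by change ([set u; v] y); rewrite -E; right.
have uE : u = x \/ u = y by change ([set x; y] u); rewrite E; left.
have vE : v = x \/ v = y by change ([set x; y] v); rewrite E; right.
by intuition congruence.
Qed.

(** * Distance, convexity and semicubes in a connected graph *)

Section Distance.
Set Implicit Arguments.
Unset Strict Implicit.
Variables (G : sgraph) (connG : connected_graph G).
Implicit Types (x y z w a b u v : G) (p : seq G) (W : set G).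

Lemma connected_ind (P : G -> Prop) x :
  P x -> (forall y z, adj y z -> P y -> P z) -> forall y, P y.
Proof.
move=> Px step y; have [p /and3P[xp _ /eqP<-]] := connG x y.
by elim: p x Px xp => //= z p IH x Px /andP[xz]; apply: IH (step _ _ xz Px).
Qed.

Lemma geodesic_ex x y : exists2 p, is_path x y p & size p = dist x y.
Proof.
rewrite /dist; case: pselect => [ex_n|]; first by case: ex_minnP => n /asboolP.
by case; have [p xpy] := connG x y; exists (size p); apply/asboolP; exists p.
Qed.

(** Distance is defined by paths without repetition; a walk shortens to such a path, whose vertices
    are among its own. *)
Lemma dist_le_walk x p : path (@adj G) x p -> dist x (last x p) <= size p.
Proof.
move=> xp; rewrite /dist; case: pselect => // ex_n; case: ex_minnP => n _ n_min.
case: (shortenP xp) n_min => p' xp' Up' p'p n_min.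
apply: leq_trans (n_min (size p') _) _; last first.
  by apply: uniq_leq_size => //; case/andP: Up'.
by apply/asboolP; exists p' => //; rewrite /is_path xp' Up' eqxx.
Qed.

Lemma dist_refl x : dist x x = 0.
Proof. by apply/eqP; rewrite -leqn0; apply: (@dist_le_walk x [::]). Qed.

Lemma dist_eq0 x y : dist x y = 0 -> x = y.
Proof.
move=> d0; have [p] := geodesic_ex x y.
by rewrite d0 => /and3P[_ _ /eqP py] /size0nil p0; rewrite p0 in py.
Qed.

Lemma dist_triangle y x z : dist x z <= dist x y + dist y z.
Proof.
have [p /and3P[xp _ /eqP py] <-] := geodesic_ex x y.
have [q /and3P[yq _ /eqP qz] <-] := geodesic_ex y z.
have := @dist_le_walk x (p ++ q).
by rewrite size_cat last_cat cat_path xp py qz; apply.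
Qed.

Lemma dist_sym x y : dist x y = dist y x.
Proof.
suff le a b : dist a b <= dist b a by apply/eqP; rewrite eqn_leq !le.
have [p /and3P[bp _ /eqP pa] <-] := geodesic_ex b a.
have := @dist_le_walk (last b p) (rev (belast b p)).
rewrite size_rev size_belast rev_path.
rewrite (eq_path (e' := @adj G)) => [/(_ bp)|u v]; last exact: adj_sym.
by rewrite pa; case: (p) pa => [/= ->//|c s _]; rewrite rev_cons last_rcons.
Qed.

Lemma dist_adj x y : adj x y -> dist x y = 1.
Proof.
move=> xy; have := @dist_le_walk x [:: y]; rewrite /= xy => /(_ isT).
case E: dist => [|[]]// _.
by move: xy; rewrite (dist_eq0 E) adj_irrefl.
Qed.

Lemma dist1_adj x y : dist x y = 1 -> adj x y.
Proof.
have [[|z [|? ?]] /and3P[xz _ /eqP <-] <-] // := geodesic_ex x y.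
by move=> _; case/andP: xz.
Qed.

Lemma dist_pred x y n : dist x y = n.+1 -> exists2 z, adj x z & dist z y = n.
Proof.
move=> dE; have [[|z p] /and3P[xp _ /eqP zy]] := geodesic_ex x y.
  by rewrite dE.
case/andP: xp => xz zp; rewrite dE => -[pn]; exists z => //.
have := dist_le_walk zp; have := dist_triangle z x y.
by rewrite (dist_adj xz) dE [last _ _]zy pn; lia.
Qed.

Lemma dist_adj_le x y w : adj x y -> dist w y <= (dist w x).+1.
Proof. by move=> xy; have := dist_triangle x w y; rewrite (dist_adj xy) addn1. Qed.

Lemma convexP W :
  convex W <->
  forall x y z, W x -> W y -> dist x z + dist z y = dist x y -> W z.
Proof.
split=> [convW x y z Wx Wy dE | convW x y p Wx Wy].
  have [p /and3P[xp Up /eqP pz] sp] := geodesic_ex x z.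
  have [q /and3P[zq Uq /eqP qy] sq] := geodesic_ex z y.
  have xpq : path (@adj G) x (p ++ q) by rewrite cat_path xp pz.
  have pqy : last x (p ++ q) = y by rewrite last_cat pz.
  have spq : size (p ++ q) = dist x y by rewrite size_cat sp sq.
  apply: (convW x y (p ++ q)) => //; last first.
    by rewrite -cat_cons mem_cat -pz mem_last.
  suff Upq : uniq (x :: p ++ q) by rewrite /is_path xpq Upq pqy eqxx.
  (* The shortened path [r] uses only vertices of the walk and, as it ends at [y], has length at
     least that of the walk, so the walk repeats no vertex. *)
  case: (shortenP xpq) pqy => r xr Ur rpq ry.
  apply: (leq_size_uniq Ur).
    by move=> t; rewrite !inE => /predU1P[->|/rpq ->]; rewrite ?eqxx ?orbT.
  by rewrite /= spq ltnS -ry; apply: dist_le_walk.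
move=> /and3P[xp _ /eqP py] sp z zp; apply: (convW x y) => //.
case/splitPl: zp xp py sp => p1 p2 p1z; rewrite cat_path last_cat p1z.
move=> /andP[xp1 zp2] py; rewrite size_cat.
have := dist_le_walk xp1; have := dist_le_walk zp2.
by rewrite p1z py; have := dist_triangle z x y; lia.
Qed.

Lemma semicube_self a b : adj a b -> semicube a b a.
Proof. by move=> ab; rewrite /semicube /= dist_refl (dist_adj ab). Qed.

Lemma semicube_disjoint {a b w} : semicube a b w -> ~ semicube b a w.
Proof. by rewrite /semicube /=; lia. Qed.

(** From [d(a,u) < d(b,u) <= d(b,v) + 1] follows [d(a,u) <= d(b,v) < d(a,v)]. *)
Lemma semicube_crossing_sym a b u v :
  adj u v -> semicube a b u -> semicube b a v -> semicube u v a.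
Proof.
rewrite adj_sym /semicube /= => vu; have := dist_adj_le b vu.
by rewrite !(dist_sym a) !(dist_sym b); lia.
Qed.

Lemma bipartite_parity (c : G -> bool) x y :
  (forall x y, adj x y -> c x != c y) -> c y = c x (+) odd (dist x y).
Proof.
move=> cE; have [p /and3P[xp _ /eqP <-] <-] := geodesic_ex x y.
elim: p x xp => [x|z p IH x] /=; first by rewrite addbF.
move=> /andP[/cE xz /IH ->].
by case: (c x) (c z) (odd _) xz => [] [] [].
Qed.

(** A tie [d(w,a) = d(w,b)] would give the adjacent vertices [a] and [b] the same colour. *)
Lemma semicube_compl a b w :
  bipartite G -> adj a b -> ~ semicube a b w -> semicube b a w.
Proof.
move=> [c cE] ab; rewrite /semicube /= => /negP; rewrite -leqNgt leq_eqVlt.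
case/predU1P => // dE; have := cE _ _ ab.
by rewrite (bipartite_parity w a cE) (bipartite_parity w b cE) dE eqxx.
Qed.

(** * Theta, opposite semicubes and their link with coherence *)

Lemma eq_opposite_semicubes x y u v :
  [set x; y] = [set u; v] -> opposite_semicubes x y = opposite_semicubes u v.
Proof. by case/set2_eq => -[-> ->] //; rewrite /opposite_semicubes setUC. Qed.

Lemma theta_intro x y u v :
  adj x y -> adj u v -> semicube x y u -> semicube y x v ->
  theta [set x; y] [set u; v].
Proof. by move=> xy uv xyu yxv; exists x, y, u, v. Qed.

Lemma theta_sym {e f} : @theta G e f -> theta f e.
Proof.
move=> [x [y [u [v [[xy eE] [uv fE] xyu yxv]]]]]; exists u, v, x, y; split=> //.
  exact: semicube_crossing_sym xyu yxv.
by apply: semicube_crossing_sym yxv xyu; rewrite adj_sym.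
Qed.

Lemma theta_crossing {x y s t} :
  theta [set x; y] [set s; t] -> semicube x y s -> ~ semicube x y t.
Proof.
move=> [x' [y' [s' [t' [[_ /set2_eq exy] [_ /set2_eq est]]]]]].
rewrite /semicube /=.
by case: exy => -[-> ->]; case: est => -[-> ->]; lia.
Qed.

Definition semicube_coherent : Prop := forall x y u v : G,
  adj x y -> adj u v -> semicube x y u -> semicube y x v ->
  semicube x y = semicube u v.

(** Crossing is symmetric in the two edges, so the inclusion for the exchanged edges is the reverse
    one. *)
Lemma coherent_of_sub :
  (forall x y u v : G, adj x y -> adj u v -> semicube x y u ->
     semicube y x v -> semicube x y `<=` semicube u v) -> semicube_coherent.
Proof.
move=> sub x y u v xy uv xyu yxv; apply/seteqP; split; first exact: sub.
apply: sub => //; first exact: semicube_crossing_sym xyu yxv.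
by apply: semicube_crossing_sym yxv xyu; rewrite adj_sym.
Qed.

(** If [w] were in [W_xy] but not in [W_uv], then [v] would lie on a geodesic from [w] to [u].
    Convexity would put [v] in [W_xy], whereas it is in [W_yx]. *)
Lemma convex_coherent : bipartite G ->
  (forall a b : G, adj a b -> convex (semicube a b)) -> semicube_coherent.
Proof.
move=> bip conv.
apply: coherent_of_sub => x y u v xy uv xyu yxv w xyw; apply: contrapT => nuvw.
apply: semicube_disjoint yxv.
have vuw := semicube_compl bip uv nuvw.
move/conv/convexP: (xy); apply; first exact: xyw; first exact: xyu.
have := dist_adj_le w uv; have /(dist_adj_le w) : adj v u by rewrite adj_sym.
have vu : adj v u by rewrite adj_sym.
by rewrite (dist_adj vu); move: vuw; rewrite /semicube /=; lia.
Qed.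

(** For transitivity: edges in relation theta have the same two semicubes, so whatever crosses one
    cut crosses the other. *)
Lemma coherent_theta_equivalence : semicube_coherent -> theta_equivalence G.
Proof.
move=> coh; split=> [e | e f | e f g].
- have [x [y [xy ->]]] := set_mem (valP e).
  apply: theta_intro => //; apply: semicube_self => //.
  by rewrite adj_sym.
- exact: theta_sym.
move=> [x [y [u [v [[xy ->] [uv ->] xyu yxv]]]]].
move=> [u' [v' [s [t [[_ /set2_eq uvE] [st ->]]]]]].
have vu : adj v u by rewrite adj_sym.
have yx : adj y x by rewrite adj_sym.
have xyE := coh _ _ _ _ xy uv xyu yxv.
have yxE := coh _ _ _ _ yx vu yxv xyu.
(* The second relation may list the middle edge as [vu]; then the ends of the third edge are
   swapped. *)
case: uvE => -[<- <-]; rewrite -xyE -yxE => hs ht; first exact: theta_intro.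
by rewrite setUC; apply: theta_intro; rewrite // adj_sym.
Qed.

Lemma theta_equivalence_coherent :
  bipartite G -> theta_equivalence G -> semicube_coherent.
Proof.
move=> bip [_ _ trans].
have theta_trans x y u v s t : adj x y -> adj u v -> adj s t ->
    theta [set x; y] [set u; v] -> theta [set u; v] [set s; t] ->
    theta [set x; y] [set s; t].
  have edge a b : adj a b -> @edges G [set a; b] by move=> ab; exists a, b.
  move=> /edge xy /edge uv /edge st.
  exact: (trans (SigSub (mem_set xy)) (SigSub (mem_set uv)) (SigSub (mem_set st))).
apply: coherent_of_sub => x y u v xy uv xyu yxv w; apply: contraPP.
have uvx := semicube_crossing_sym uv xyu yxv.
(* A geodesic from [w] to [x] stays in [W_xy]; the edge by which it enters
   [W_uv] is in relation theta with [uv], hence with [xy]. *)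
elim: {w}(dist w x) {-2}w (erefl (dist w x)) => [w /dist_eq0 -> //|n IH w dE].
move=> nuvw xyw; have [w' ww' dE'] := dist_pred dE.
have xyw' : semicube x y w'.
  move: xyw; have /(dist_adj_le y) : adj w' w by rewrite adj_sym.
  by rewrite /semicube /= dE dE' !(dist_sym y); lia.
have [uvw'|nuvw'] := pselect (semicube u v w'); last exact: IH xyw'.
have w'w : adj w' w by rewrite adj_sym.
have uv_w : theta [set u; v] [set w'; w].
  by apply: theta_intro => //; apply: semicube_compl.
apply: theta_crossing xyw' xyw.
by apply: theta_trans uv_w => //; apply: theta_intro.
Qed.

Lemma coherent_theta_opposite : semicube_coherent ->
  forall x y u v : G, adj x y -> adj u v -> theta [set x; y] [set u; v] ->
  opposite_semicubes x y = opposite_semicubes u v.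
Proof.
move=> coh x y u v _ _ [x' [y' [u' [v' [[xy xyE] [uv uvE] xyu yxv]]]]].
rewrite (eq_opposite_semicubes xyE) (eq_opposite_semicubes uvE).
rewrite /opposite_semicubes (coh _ _ _ _ xy uv xyu yxv).
by rewrite (coh y' x' v' u') // adj_sym.
Qed.

Lemma separates_opposite u v x y :
  adj u v -> adj x y -> separates (opposite_semicubes u v) x y ->
  theta [set u; v] [set x; y].
Proof.
move=> uv xy [A [B [/set2_eq[] [<- <-] Ax By]]]; first exact: theta_intro.
by rewrite [X in theta _ X]setUC; apply: theta_intro; rewrite // adj_sym.
Qed.

Lemma unique_opposite_coherent :
  (forall x y : G, adj x y ->
     exists! S : set (set G), opposite_pair S /\ separates S x y) ->
  semicube_coherent.
Proof.
move=> uniqS x y u v xy uv xyu yxv.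
have [S [_ SE]] := uniqS _ _ uv.
have E1 : S = opposite_semicubes x y.
  apply: SE; split; first by exists x, y.
  by exists (semicube x y), (semicube y x).
have E2 : S = opposite_semicubes u v.
  apply: SE; split; first by exists u, v.
  exists (semicube u v), (semicube v u); split=> //; apply: semicube_self => //.
  by rewrite adj_sym.
(* Both pairs separate [u] from [v], so they agree. The swapped matching [W_xy = W_vu] would put [u]
   in [W_vu]. *)
case/set2_eq: (etrans (esym E1) E2) => -[E _] //.
move: xyu; rewrite E => vuu; case: (semicube_disjoint vuu).
exact: semicube_self.
Qed.

End Distance.

(** * Distance and semicubes in hypercubes *)

Section HypercubeDistance.
Set Implicit Arguments.
Unset Strict Implicit.
Variable X : choiceType.
Implicit Types (P Q R A B : {fset X}) (t : X).

(** Convertible to the set counted in [hypercube_adj], so that adjacency means that [symd] is a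
    singleton. *)
Definition symd P Q : {fset X} := ((P `\` Q) `|` (Q `\` P))%fset.

Lemma in_symd t P Q : (t \in symd P Q) = (t \in P) (+) (t \in Q).
Proof. by rewrite !inE; case: (t \in P); case: (t \in Q). Qed.

Lemma symdC P Q : symd P Q = symd Q P.
Proof. by rewrite /symd fsetUC. Qed.

Lemma symdPP P : symd P P = fset0.
Proof. by apply/fsetP => z; rewrite in_symd addbb inE. Qed.

Lemma symd0_eq P Q : symd P Q = fset0 -> P = Q.
Proof.
move=> /fsetP E; apply/fsetP => z; move: (E z); rewrite in_symd inE.
by case: (z \in P); case: (z \in Q).
Qed.

Lemma symd_flip P t : symd P (symd P [fset t]%fset) = [fset t]%fset.
Proof. by apply/fsetP => z; rewrite !in_symd addbA addbb. Qed.

Lemma hypercube_adjP P Q :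
  reflect (exists t, symd P Q = [fset t]%fset) (hypercube_adj P Q).
Proof. exact: cardfs1P. Qed.

Lemma card_symd_step t R P Q : symd P Q = [fset t]%fset -> t \notin symd R P ->
  #|` symd R Q| = #|` symd R P|.+1.
Proof.
move=> /fsetP PQ tRP.
suff -> : symd R Q = (t |` symd R P)%fset by rewrite cardfsU1 tRP.
apply/fsetP => z; move: (PQ z); rewrite in_fset1U !in_symd in_fset1.
case: eqVneq tRP => [<-|_ _]; rewrite ?in_symd;
  by case: (z \in R); case: (z \in P); case: (z \in Q).
Qed.

(** Upper bound: flipping in [Q] an element of the symmetric difference gives a neighbour of [Q]
    whose difference from [P] is smaller by one. Lower bound: each edge of a path adds at most one
    element to the difference from [P]. *)
Lemma hypercube_dist P Q : @dist (hypercube X) P Q = #|` symd P Q|.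
Proof.
have conn := @hypercube_connected X.
apply/eqP; rewrite eqn_leq; apply/andP; split.
  elim: {Q}#|`_| {-2}Q (erefl #|` symd P Q|) => [Q /cardfs0_eq/symd0_eq ->|n IH Q cQ].
    by rewrite dist_refl.
  have [t tPQ] : exists t, t \in symd P Q.
    by apply/fset0Pn; rewrite -cardfs_gt0 cQ.
  pose Q' := symd Q [fset t]%fset.
  have Q'Q : symd Q' Q = [fset t]%fset by rewrite symdC symd_flip.
  have tPQ' : t \notin symd P Q'.
    by move: tPQ; rewrite !in_symd inE eqxx; case: (_ \in P); case: (_ \in Q).
  have := card_symd_step Q'Q tPQ'; rewrite cQ => -[cQ'].
  have adjQ'Q : @adj (hypercube X) Q' Q by apply/hypercube_adjP; exists t.
  apply: leq_trans (dist_adj_le conn P adjQ'Q) _.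
  by rewrite ltnS cQ' IH.
have [p /and3P[+ _ /eqP +] sp] := geodesic_ex conn P Q.
rewrite -{}sp.
elim/last_ind: p Q => [Q _ <-|p Q' IH Q]; first by rewrite symdPP cardfs0.
rewrite rcons_path last_rcons size_rcons => /andP[Pp lQ'] <-.
have := IH _ Pp erefl; case/hypercube_adjP: lQ' => t.
move: (last P p) => R RQ' leR.
(* If [t] is already in the difference, the edge removes it; the count then comes from the same edge
   read backwards. *)
have [tPR|tPR] := boolP (t \in symd P R); last by rewrite (card_symd_step RQ' tPR).
rewrite symdC in RQ'.
have tPQ' : t \notin symd P Q'.
  have := fset11 t; rewrite -RQ'; move: tPR; rewrite !in_symd.
  by case: (_ \in P); case: (_ \in Q'); case: (_ \in R).
by have := card_symd_step RQ' tPQ'; lia.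
Qed.

Lemma hypercube_semicube A B R t : symd A B = [fset t]%fset ->
  @semicube (hypercube X) A B R <-> (t \in R) = (t \in A).
Proof.
move=> AB; rewrite /semicube /= !hypercube_dist.
have tAB : (t \in A) (+) (t \in B) by rewrite -in_symd AB fset11.
split=> [lt|tRA]; last first.
  by rewrite (card_symd_step AB) // in_symd tRA addbb.
apply/eqP; case: eqP lt => // /eqP tRA.
rewrite symdC in AB; rewrite (card_symd_step AB); first by lia.
by move: tRA tAB; rewrite in_symd; case: (_ \in R) (_ \in A) (_ \in B) => [] [] [].
Qed.

Lemma hypercube_bipartite : bipartite (hypercube X).
Proof.
exists (fun P => odd #|` P|) => P Q /hypercube_adjP[t PQ].
wlog tP : P Q PQ / t \in P => [wl|].
  have := fset11 t; rewrite -PQ in_symd.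
  case tP: (t \in P); first by move=> _; apply: wl.
  by move=> tQ; rewrite eq_sym; apply: wl => //; rewrite symdC.
have -> : Q = (P `\ t)%fset.
  apply/fsetP => z; move/fsetP/(_ z): PQ; rewrite in_symd !inE.
  by case: eqVneq tP => [<-|_ _]; case: (z \in P); case: (z \in Q).
by rewrite (cardfsD1 t) tP /=; case: odd.
Qed.

Lemma hypercube_semicube_convex A B : @adj (hypercube X) A B ->
  convex (@semicube (hypercube X) A B).
Proof.
have conn := @hypercube_connected X.
move=> /hypercube_adjP[t AB]; apply/(convexP conn) => P Q R.
rewrite !(hypercube_semicube _ AB) => tP tQ dE; apply/eqP; apply: contraT => tR.
pose R' : {fset X} := symd R [fset t]%fset.
have R'R : symd R' R = [fset t]%fset by rewrite symdC symd_flip.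
have step (S : {fset X}) : (t \in S) = (t \in A) -> #|` symd S R| = #|` symd S R'|.+1.
  move=> tS; apply: (card_symd_step R'R); rewrite !in_symd inE eqxx tS.
  by move: tR; case: (t \in R); case: (t \in A).
(* Flipping [t] in [R] shortens both halves of a geodesic through [R]. *)
have := dist_triangle conn (R' : hypercube X) P Q; rewrite -dE.
rewrite (dist_sym conn R' Q) (dist_sym conn R Q) !hypercube_dist.
by rewrite (step P tP) (step Q tQ) addSn addnS => /ltnW; rewrite ltnn.
Qed.

End HypercubeDistance.

(** * Isometric subgraphs of hypercubes, and the embedding by semicubes *)

Section Embedding.
Set Implicit Arguments.
Unset Strict Implicit.
Variables (G : sgraph) (connG : connected_graph G).

Lemma isometric_adj (H : sgraph) (f : G -> H) (a b : G) :
  connected_graph H -> isometric f -> adj a b -> adj (f a) (f b).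
Proof. by move=> connH isof /(dist_adj connG) ab; apply: dist1_adj; rewrite ?isof. Qed.

Lemma isometric_semicube (H : sgraph) (f : G -> H) (a b : G) :
  isometric f -> semicube a b = f @^-1` semicube (f a) (f b).
Proof. by move=> isof; apply/seteqP; split=> w; rewrite /semicube /= !isof. Qed.

Lemma partial_cube_bipartite : partial_cube G -> bipartite G.
Proof.
move=> [X [f isof]]; have [c cE] := hypercube_bipartite X.
exists (c \o f) => x y xy; apply: cE.
by apply: isometric_adj xy => //; apply: hypercube_connected.
Qed.

(** The form of convexity in [convexP] mentions distances alone, so it pulls back along an
    isometry. *)
Lemma partial_cube_convex (a b : G) :
  partial_cube G -> adj a b -> convex (semicube a b).
Proof.
move=> [X [f isof]] ab; have connX := @hypercube_connected X.
rewrite (isometric_semicube a b isof); apply/(convexP connG) => x y z fx fy dE.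
move/(isometric_adj connX isof)/hypercube_semicube_convex/(convexP connX): ab.
by apply; [exact: fx | exact: fy | rewrite !isof].
Qed.

Hypotheses (bip : bipartite G) (coh : semicube_coherent G).

(** Hence an edge leaves no semicube other than its own, which is why the embedding changes by a
    single element along it. *)
Lemma coherent_semicube_cut (x y a b : G) :
  adj x y -> adj a b -> semicube a b x -> ~ semicube a b y ->
  semicube a b = semicube x y.
Proof. by move=> xy ab abx /(semicube_compl connG bip ab); apply: coh. Qed.

Variable r : G.

(** Semicubes are taken as sets, so all edges across one cut contribute the same element; omitting
    those that contain [r] keeps one side of each cut between [z] and [r]. *)
Definition separating_semicubes (z : G) : set (set G) :=
  [set W | (exists a b, adj a b /\ W = semicube a b) /\ W z /\ ~ W r].

(** The set is empty at [r], and passing from [y] to a neighbour [z] can add only [W_zy]. *)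
Lemma separating_semicubes_finite z : finite_set (separating_semicubes z).
Proof.
apply: (connected_ind connG (P := finite_set \o separating_semicubes) (x := r))
  => [|y {}z yz finy] /=.
  by apply: (sub_finite_set (B := set0)) => // W [_ []].
apply: (sub_finite_set (B := [set semicube z y] `|` separating_semicubes y)).
  move=> _ [[a [b [ab ->]]] [Wz nWr]].
  have [Wy|nWy] := pselect (semicube a b y); first by right; split=> //; exists a, b.
  by left; apply: coherent_semicube_cut => //; rewrite adj_sym.
by rewrite finite_setU; split=> //; apply: finite_set1.
Qed.

(** [fset_set] returns the empty set on infinite arguments; finiteness gives it the intended
    members. *)
Definition semicube_map (z : G) : hypercube (set G) :=
  fset_set (separating_semicubes z).

Lemma in_semicube_map z W : W \in semicube_map z <-> separating_semicubes z W.
Proof.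
rewrite in_fset_set; last exact: separating_semicubes_finite.
by split=> [/set_mem|/mem_set].
Qed.

(** The element that changes is the side of the cut of [xy] that misses [r]; by symmetry this may be
    taken to be [W_xy]. *)
Lemma semicube_map_adj (x y : G) : adj x y ->
  exists2 W, W = semicube x y \/ W = semicube y x &
    symd (semicube_map x) (semicube_map y) = [fset W]%fset.
Proof.
wlog yxr : x y / semicube y x r => [wl xy|xy].
  have yx : adj y x by rewrite adj_sym.
  have [yxr|] := pselect (semicube y x r); first exact: wl.
  move/(semicube_compl connG bip yx) => /wl/(_ yx)[W WE symE].
  by exists W; rewrite 1?symdC //; case: WE; auto.
have yx : adj y x by rewrite adj_sym.
exists (semicube x y); first by left.
apply/fsetP => W; rewrite in_symd inE; apply/idP/eqP => [|->]; last first.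
  have -> : semicube x y \in semicube_map x.
    apply/in_semicube_map; split; first by exists x, y.
    by split; [exact: semicube_self | exact: semicube_disjoint yxr].
  apply/negP => /in_semicube_map[_ [xyy _]].
  by apply: semicube_disjoint xyy _; apply: semicube_self.
have [/in_semicube_map[[a [b [ab ->]]] [abx abr]]|Wx] := boolP (W \in _).
  move=> /negP Wy; apply: coherent_semicube_cut => // aby; apply: Wy.
  by apply/in_semicube_map; split; first by exists a, b.
(* A semicube containing [y] but not [x] is [W_yx], which contains [r] and is therefore excluded. *)
move=> /in_semicube_map[[a [b [ab WE]]] [Wy Wr]]; exfalso.
rewrite {W}WE in Wx Wy Wr *.
have abx : ~ semicube a b x.
  move=> abx; case/negP: Wx; apply/in_semicube_map.
  by split; first by exists a, b.
by apply: Wr; rewrite (coherent_semicube_cut yx ab Wy abx).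
Qed.

Lemma semicube_map_isometric : isometric semicube_map.
Proof.
move=> w z; rewrite hypercube_dist; move En: (dist w z) => n.
elim: n z En => [z /(dist_eq0 connG) ->|n IH z dwz]; first by rewrite symdPP cardfs0.
have [y] : exists2 y, adj z y & dist y w = n.
  by apply: dist_pred; rewrite // dist_sym.
rewrite adj_sym dist_sym // => yz dwy.
have [W WE symE] := semicube_map_adj yz.
have yzw : semicube y z w by rewrite /semicube /= dwy dwz.
have yzy : semicube y z y by apply: semicube_self.
(* Both [w] and [y] lie in [W_yz], so each side of this cut contains both or neither. Thus [W] is
   not in the difference of their images, and the step to [z] adds it. *)
have Wwy : W w <-> W y.
  case: WE => ->; split=> // W_zy; first by case: (semicube_disjoint yzw).
  by case: (semicube_disjoint yzy).
rewrite (card_symd_step symE) ?IH // in_symd.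
suff -> : (W \in semicube_map w) = (W \in semicube_map y) by rewrite addbb.
apply/idP/idP => /in_semicube_map[scW [/Wwy Wy nWr]];
  by apply/in_semicube_map.
Qed.

End Embedding.

Theorem theorem3p4 (G : sgraph) (connG : connected_graph G) :
  [<-> partial_cube G;
       bipartite G /\
         (forall a b : G, adj a b -> convex (semicube a b));
       bipartite G /\ theta_equivalence G;
       bipartite G /\
         (forall x y u v : G, adj x y -> adj u v ->
            theta [set x; y] [set u; v] ->
            opposite_semicubes x y = opposite_semicubes u v);
       bipartite G /\
         (forall x y : G, adj x y ->
            exists! S : set (set G), opposite_pair S /\ separates S x y)].
Proof.
tfae.
- move=> pcG; split; first exact: partial_cube_bipartite.
  by move=> a b; apply: partial_cube_convex.
- move=> [bip conv]; split=> //.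
  by apply: coherent_theta_equivalence => //; apply: convex_coherent.
- move=> [bip thetaE]; split=> //.
  by apply: coherent_theta_opposite; apply: theta_equivalence_coherent.
- move=> [bip opp]; split=> // x y xy.
  have yx : adj y x by rewrite adj_sym.
  exists (opposite_semicubes x y); split=> [|S [[u [v [uv ->]]]]].
    split; first by exists x, y.
    by exists (semicube x y), (semicube y x); split=> //; apply: semicube_self.
  (* Separation says that [xy] crosses the cut of [uv]; symmetry of theta turns this into the order
     required by (iv). *)
  by move=> /(separates_opposite uv xy)/(theta_sym connG); apply: opp.
- move=> [bip uniqS]; have [r] := vertex_inhabited G.
  exists (set G), (semicube_map r); apply: semicube_map_isometric => //.
  exact: unique_opposite_coherent.
Qed.
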